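(* Let $y:\mathbb{R}^n\to\mathbb{R}^m$ have vector relative degree $r=(r_1,\dots,r_m)$ on an open set $\mathcal{E}\supset\mathcal{S}$ for the system $\dot x=f(x)+g(x)u$, and suppose that $\alpha^i_1>0$ and $\overline{y}_i>\underline{y}_i$ for all $i\in\{1,\dots,m\}$. Let $k_{\rm d}:\mathbb{R}^n\to\mathbb{R}^m$ and let $G(x)=B(x)^\top B(x)$, where $B$ is the decoupling matrix. Then for every $x\in\mathcal{E}$ the primal-dual solution $(u^*(x),\lambda^*(x))$ of the quadratic program $$\min_{u\in\mathbb{R}^m}\ \tfrac12(u-k_{\rm d}(x))^\top G(x)(u-k_{\rm d}(x))$$ subject to, for all $i\in\{1,\dots,m\}$, $$L_f^{r_i}\underline{h}_i(x)+L_gL_f^{r_i-1}\underline{h}_i(x)\,u+\alpha_i^\top\underline{H}_i(x)\ \ge\ 0,\qquad L_f^{r_i}\overline{h}_i(x)+L_gL_f^{r_i-1}\overline{h}_i(x)\,u+\alpha_i^\top\overline{H}_i(x)\ \ge\ 0,$$ is given by $$u^*(x)=k_{\rm d}(x)+\sum_{i=1}^m\big(\underline{\lambda}_i^*(x)-\overline{\lambda}_i^*(x)\big)G(x)^{-1}b_i(x),$$ $$\underline{\lambda}_i^*(x)=\max\{0,-\underline{\omega}_i(x)\},\qquad \overline{\lambda}_i^*(x)=\max\{0,-\overline{\omega}_i(x)\},$$ $$\underline{\omega}_i(x)=a_i(x)+\alpha_1^i(y_i(x)-\underline{y}_i)+b_i(x)^\top k_{\rm d}(x),$$ $$\overline{\omega}_i(x)=-a_i(x)-\alpha_1^i(y_i(x)-\overline{y}_i)-b_i(x)^\top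 k_{\rm d}(x),$$ where $a_i(x)=L_f^{r_i}y_i(x)+\sum_{j=1}^{r_i-1}\alpha^i_{j+1}L_f^jy_i(x)$, and $\lambda^*=(\underline{\lambda}_1^*,\overline{\lambda}_1^*,\dots,\underline{\lambda}_m^*,\overline{\lambda}_m^* )$, with $\underline{\lambda}_i^*$ and $\overline{\lambda}_i^*$ the Lagrange multipliers of the $i$-th constraint involving $\underline{h}_i$ and $\overline{h}_i$, respectively.
   Context: System: $\dot x=f(x)+g(x)u$ with $x\in\mathbb{R}^n$, $u\in\mathbb{R}^m$, where $f:\mathbb{R}^n\to\mathbb{R}^n$ and $g:\mathbb{R}^n\to\mathbb{R}^{n\times m}$ are smooth (continuously differentiable as many times as necessary). The output $y=(y_1,\dots,y_m):\mathbb{R}^n\to\mathbb{R}^m$ is smooth. Lie derivatives: $L_fh(x)=\frac{\partial h}{\partial x}(x)f(x)$, $L_f^0h=h$, $L_f^ih=L_f(L_f^{i-1}h)$, and $L_gh(x)=\frac{\partial h}{\partial x}(x)g(x)\in\mathbb{R}^{1\times m}$. Vector relative degree: $y$ has vector relative degree $r=(r_1,\dots,r_m)$ (positive integers) at $x$ if for all $i$, $L_gL_f^jy_i(x)=0$ for all $j\in\{0,\dots,r_i-2\}$, and the decoupling matrix $B(x)\in\mathbb{R}^{m\times m}$, whose $i$-th row is $b_i(x)^\top:=L_gL_f^{r_i-1}y_i(x)$, is invertible. It has vector relative degree $r$ on a set if this holds at each point of the set (with the same $r$). Bounds and gains: $\underline{y}_i,\overline{y}_i\in\mathbb{R}$.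 For each $i$, $\alpha_i=(\alpha_1^i,\dots,\alpha_{r_i}^i)\in\mathbb{R}^{r_i}$ is such that $s^{r_i}+\alpha^i_{r_i}s^{r_i-1}+\dots+\alpha^i_2s+\alpha^i_1=\prod_{j=1}^{r_i}(s-\nu^i_j)$ with all $\nu^i_j$ real and negative. Barrier functions: $\underline{h}_i(x)=y_i(x)-\underline{y}_i$, $\overline{h}_i(x)=\overline{y}_i-y_i(x)$, $\underline{H}_i(x)=(\underline{h}_i(x),L_f\underline{h}_i(x),\dots,L_f^{r_i-1}\underline{h}_i(x))^\top$, and $\overline{H}_i(x)=(\overline{h}_i(x),L_f\overline{h}_i(x),\dots,L_f^{r_i-1}\overline{h}_i(x))^\top$. Safe set: for $h\in\{\underline{h}_i,\overline{h}_i\}$ define recursively $\psi_0=h$ and $\psi_j=L_f\psi_{j-1}-\nu^i_j\psi_{j-1}$ for $j=1,\dots,r_i-1$ (on $\mathcal{E}$, $L_f\psi_{j-1}$ equals the time derivative of $\psi_{j-1}$ along the system, for any input). Set $\underline{\mathcal{S}}_i=\bigcap_{j=0}^{r_i-1}\{x\in\mathbb{R}^n:\psi_j(x)\ge0\}$ for $h=\underline{h}_i$, and $\overline{\mathcal{S}}_i$ likewise for $h=\overline{h}_i$. Then $\mathcal{S}:=\bigcap_{i=1}^m(\underline{\mathcal{S}}_i\cap\overline{\mathcal{S}}_i)$. Primal-dual solution: for a program minimizing $J(u)$ subject to $c_j+d_j^\top u\ge0$, $j\in\{1,\dots,2m\}$, the Lagrangian is $L(u,\lambda)=J(u)-\sum_j\lambda_j(c_j+d_j^\top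 u)$; a primal-dual solution is a pair $(u^*,\lambda^* )$ with $u^*$ optimal and satisfying the Karush-Kuhn-Tucker conditions: $\partial L/\partial u(u^*,\lambda^* )=0$, $c_j+d_j^\top u^*\ge0$, $\lambda_j^*\ge0$, and $\lambda_j^*(c_j+d_j^\top u^* )=0$ for all $j$. *)

(* Defs.v *)
From mathcomp Require Export all_boot all_order all_algebra.
From mathcomp Require Export all_classical all_reals all_analysis.
Export Order.TTheory GRing.Theory Num.Theory.
Export numFieldNormedType.Exports.

#[export] Set Implicit Arguments.
#[export] Unset Strict Implicit.
#[export] Unset Printing Implicit Defensive.

#[global] Open Scope classical_set_scope.
#[global] Open Scope ring_scope.

(* On a finite-dimensional [V], continuity of all iterated directional
   derivatives amounts to continuity of all iterated partial derivatives, so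
   this is the usual class C^k. *)
Fixpoint Ck (R : realType) (V W : normedModType R) (k : nat) (F : V -> W) :
    Prop :=
  if k is k'.+1 then
    (forall x, differentiable F x) /\ (forall v, Ck k' (fun x => 'D_v F x))
  else continuous F.

(* The row vector of partial derivatives; the library's ['J] is the transposed
   Jacobian of maps between spaces of row vectors. *)
Definition grad (R : realType) (n : nat) (h : 'cV[R]_n -> R) (x : 'cV[R]_n) :
    'rV[R]_n :=
  \row_j 'D_(delta_mx j 0) h x.

Definition lie (R : realType) (n : nat) (f : 'cV[R]_n -> 'cV[R]_n)
    (h : 'cV[R]_n -> R) (x : 'cV[R]_n) : R :=
  (grad h x *m f x) 0 0.

Definition lie_iter (R : realType) (n : nat) (f : 'cV[R]_n -> 'cV[R]_n)
    (k : nat) (h : 'cV[R]_n -> R) : 'cV[R]_n -> R :=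
  iter k (lie f) h.

Definition lie_in (R : realType) (n m : nat) (g : 'cV[R]_n -> 'M[R]_(n, m))
    (h : 'cV[R]_n -> R) (x : 'cV[R]_n) : 'rV[R]_m :=
  grad h x *m g x.

Definition component (R : realType) (n m : nat) (y : 'cV[R]_n -> 'cV[R]_m)
    (i : 'I_m) (x : 'cV[R]_n) : R :=
  y x i 0.

Definition decoupling (R : realType) (n m : nat) (f : 'cV[R]_n -> 'cV[R]_n)
    (g : 'cV[R]_n -> 'M[R]_(n, m)) (y : 'cV[R]_n -> 'cV[R]_m)
    (r : 'I_m -> nat) (x : 'cV[R]_n) : 'M[R]_m :=
  \matrix_(i < m) lie_in g (lie_iter f (r i).-1 (component y i)) x.

Definition decoupling_vec (R : realType) (n m : nat)
    (f : 'cV[R]_n -> 'cV[R]_n) (g : 'cV[R]_n -> 'M[R]_(n, m))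
    (y : 'cV[R]_n -> 'cV[R]_m) (r : 'I_m -> nat) (i : 'I_m) (x : 'cV[R]_n) :
    'cV[R]_m :=
  (row i (decoupling f g y r x))^T.

Definition vector_relative_degree_at (R : realType) (n m : nat)
    (f : 'cV[R]_n -> 'cV[R]_n) (g : 'cV[R]_n -> 'M[R]_(n, m))
    (y : 'cV[R]_n -> 'cV[R]_m) (r : 'I_m -> nat) (x : 'cV[R]_n) : Prop :=
  (forall (i : 'I_m) (j : nat), (j.+2 <= r i)%N ->
     lie_in g (lie_iter f j (component y i)) x = 0) /\
  decoupling f g y r x \in unitmx.

Definition vector_relative_degree_on (R : realType) (n m : nat)
    (f : 'cV[R]_n -> 'cV[R]_n) (g : 'cV[R]_n -> 'M[R]_(n, m))
    (y : 'cV[R]_n -> 'cV[R]_m) (r : 'I_m -> nat) (E : set 'cV[R]_n) : Prop :=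
  (forall i, (0 < r i)%N) /\
  (forall x, E x -> vector_relative_degree_at f g y r x).

Definition h_lo (R : realType) (n m : nat) (y : 'cV[R]_n -> 'cV[R]_m)
    (ylo : 'I_m -> R) (i : 'I_m) (x : 'cV[R]_n) : R :=
  component y i x - ylo i.

Definition h_up (R : realType) (n m : nat) (y : 'cV[R]_n -> 'cV[R]_m)
    (yup : 'I_m -> R) (i : 'I_m) (x : 'cV[R]_n) : R :=
  yup i - component y i x.

Definition H_vec (R : realType) (n : nat) (f : 'cV[R]_n -> 'cV[R]_n)
    (ri : nat) (h : 'cV[R]_n -> R) (x : 'cV[R]_n) : 'cV[R]_ri :=
  \col_(j < ri) lie_iter f j h x.

(* Finite families indexed by 1, ..., ri are represented by functions on [nat],
   of which only the values at 1, ..., ri are used. *)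
Definition gain_vec (R : realType) (ri : nat) (al : nat -> R) : 'cV[R]_ri :=
  \col_(j < ri) al j.+1.

Definition stable_gains (R : realType) (ri : nat) (al nu : nat -> R) : Prop :=
  'X^ri + \sum_(1 <= j < ri.+1) al j *: 'X^(j.-1)
    = \prod_(1 <= j < ri.+1) ('X - (nu j)%:P) /\
  (forall j, (1 <= j <= ri)%N -> nu j < 0).

Fixpoint psi (R : realType) (n : nat) (f : 'cV[R]_n -> 'cV[R]_n)
    (nu : nat -> R) (h : 'cV[R]_n -> R) (j : nat) : 'cV[R]_n -> R :=
  if j is j'.+1 then
    fun x => lie f (psi f nu h j') x - nu j * psi f nu h j' x
  else h.

Definition safe_set_of (R : realType) (n : nat) (f : 'cV[R]_n -> 'cV[R]_n)
    (ri : nat) (nu : nat -> R) (h : 'cV[R]_n -> R) : set 'cV[R]_n :=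
  \bigcap_(j in [set j | (j < ri)%N]) [set x | 0 <= psi f nu h j x].

Definition safe_set (R : realType) (n m : nat) (f : 'cV[R]_n -> 'cV[R]_n)
    (y : 'cV[R]_n -> 'cV[R]_m) (r : 'I_m -> nat) (nu : 'I_m -> nat -> R)
    (ylo yup : 'I_m -> R) : set 'cV[R]_n :=
  \bigcap_(i in [set: 'I_m])
    (safe_set_of f (r i) (nu i) (h_lo y ylo i) `&`
     safe_set_of f (r i) (nu i) (h_up y yup i)).

Definition constraint (R : realType) (m : nat) (I : finType) (c : I -> R)
    (d : I -> 'cV[R]_m) (u : 'cV[R]_m) (j : I) : R :=
  c j + ((d j)^T *m u) 0 0.

Definition feasible (R : realType) (m : nat) (I : finType) (c : I -> R)
    (d : I -> 'cV[R]_m) (u : 'cV[R]_m) : Prop :=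
  forall j, 0 <= constraint c d u j.

Definition optimal (R : realType) (m : nat) (I : finType)
    (J : 'cV[R]_m -> R) (c : I -> R) (d : I -> 'cV[R]_m) (u : 'cV[R]_m) :
    Prop :=
  feasible c d u /\ (forall v, feasible c d v -> J u <= J v).

Definition lagrangian (R : realType) (m : nat) (I : finType)
    (J : 'cV[R]_m -> R) (c : I -> R) (d : I -> 'cV[R]_m) (u : 'cV[R]_m)
    (lam : I -> R) : R :=
  J u - \sum_j lam j * constraint c d u j.

Definition KKT (R : realType) (m : nat) (I : finType)
    (J : 'cV[R]_m -> R) (c : I -> R) (d : I -> 'cV[R]_m) (u : 'cV[R]_m)
    (lam : I -> R) : Prop :=
  [/\ grad (fun v => lagrangian J c d v lam) u = 0,
      feasible c d u,
      forall j, 0 <= lam j &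
      forall j, lam j * constraint c d u j = 0].

Definition primal_dual_solution (R : realType) (m : nat) (I : finType)
    (J : 'cV[R]_m -> R) (c : I -> R) (d : I -> 'cV[R]_m) (u : 'cV[R]_m)
    (lam : I -> R) : Prop :=
  optimal J c d u /\ KKT J c d u lam.

Definition qp_weight (R : realType) (n m : nat) (f : 'cV[R]_n -> 'cV[R]_n)
    (g : 'cV[R]_n -> 'M[R]_(n, m)) (y : 'cV[R]_n -> 'cV[R]_m)
    (r : 'I_m -> nat) (x : 'cV[R]_n) : 'M[R]_m :=
  (decoupling f g y r x)^T *m decoupling f g y r x.

Definition qp_cost (R : realType) (m : nat) (G : 'M[R]_m) (kdx : 'cV[R]_m)
    (u : 'cV[R]_m) : R :=
  2^-1 * ((u - kdx)^T *m G *m (u - kdx)) 0 0.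

(* The 2m constraints are indexed by ['I_m * bool]: (i, false) is the
   constraint of the lower bound on y_i and (i, true) that of the upper one. *)
Definition qp_barrier (R : realType) (n m : nat) (y : 'cV[R]_n -> 'cV[R]_m)
    (ylo yup : 'I_m -> R) (k : 'I_m * bool) : 'cV[R]_n -> R :=
  if k.2 then h_up y yup k.1 else h_lo y ylo k.1.

Definition qp_c (R : realType) (n m : nat) (f : 'cV[R]_n -> 'cV[R]_n)
    (y : 'cV[R]_n -> 'cV[R]_m) (r : 'I_m -> nat) (al : 'I_m -> nat -> R)
    (ylo yup : 'I_m -> R) (x : 'cV[R]_n) (k : 'I_m * bool) : R :=
  let h := qp_barrier y ylo yup k in
  lie_iter f (r k.1) h x
    + ((gain_vec (r k.1) (al k.1))^T *m H_vec f (r k.1) h x) 0 0.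

Definition qp_d (R : realType) (n m : nat) (f : 'cV[R]_n -> 'cV[R]_n)
    (g : 'cV[R]_n -> 'M[R]_(n, m)) (y : 'cV[R]_n -> 'cV[R]_m)
    (r : 'I_m -> nat) (ylo yup : 'I_m -> R) (x : 'cV[R]_n)
    (k : 'I_m * bool) : 'cV[R]_m :=
  (lie_in g (lie_iter f (r k.1).-1 (qp_barrier y ylo yup k)) x)^T.

Definition drift (R : realType) (n m : nat) (f : 'cV[R]_n -> 'cV[R]_n)
    (y : 'cV[R]_n -> 'cV[R]_m) (r : 'I_m -> nat) (al : 'I_m -> nat -> R)
    (i : 'I_m) (x : 'cV[R]_n) : R :=
  lie_iter f (r i) (component y i) x
    + \sum_(1 <= j < r i) al i j.+1 * lie_iter f j (component y i) x.

Definition omega_lo (R : realType) (n m : nat) (f : 'cV[R]_n -> 'cV[R]_n)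
    (g : 'cV[R]_n -> 'M[R]_(n, m)) (y : 'cV[R]_n -> 'cV[R]_m)
    (r : 'I_m -> nat) (al : 'I_m -> nat -> R) (ylo : 'I_m -> R)
    (kd : 'cV[R]_n -> 'cV[R]_m) (i : 'I_m) (x : 'cV[R]_n) : R :=
  drift f y r al i x + al i 1%N * (component y i x - ylo i)
    + ((decoupling_vec f g y r i x)^T *m kd x) 0 0.

Definition omega_up (R : realType) (n m : nat) (f : 'cV[R]_n -> 'cV[R]_n)
    (g : 'cV[R]_n -> 'M[R]_(n, m)) (y : 'cV[R]_n -> 'cV[R]_m)
    (r : 'I_m -> nat) (al : 'I_m -> nat -> R) (yup : 'I_m -> R)
    (kd : 'cV[R]_n -> 'cV[R]_m) (i : 'I_m) (x : 'cV[R]_n) : R :=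
  - drift f y r al i x - al i 1%N * (component y i x - yup i)
    - ((decoupling_vec f g y r i x)^T *m kd x) 0 0.

(* Main.v *)
Require Import Defs.
From mathcomp Require Import ring lra.

(* In the coordinates v = B (u - kd) the weight G = B^T B turns the program into
   the minimization of |v|^2 / 2 under the decoupled bounds
   - omega_lo i <= v_i <= omega_up i, and G^-1 b_i becomes the i-th basis vector.
   Since omega_lo i + omega_up i = alpha_1^i (yup i - ylo i) > 0, at most one
   bound on each v_i is active, which determines the multipliers. *)

(* No differentiability is needed: where the difference quotient diverges, both
   derivatives take the junk value 0. This is why the lemmas on Lie derivatives
   below need no smoothness. *)
Lemma derive_oppE (R : realType) (V : normedModType R) (h : V -> R) (x v : V) :
  'D_v (fun z => - h z) x = - 'D_v h x.
Proof.
have [dh|ndh] := pselect (derivable h x v); first exact: deriveN.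
rewrite /derive [in RHS]dvgP //= [LHS]dvgP.
  by rewrite oppr0.
rewrite (_ : (fun t : R => _) =
    - (fun t : R => t^-1 *: ((h \o shift x) (t *: v) - h x))).
  by rewrite is_cvgNE.
by apply/funext => t /=; rewrite opprfctE -scalerN opprB opprK addrC.
Qed.

(** For [t != 0] the difference quotient is exactly [a + t * b], which tends to [a]. A gradient can
    thus be read off the expansion of a quadratic function along a line. *)
Lemma derive_quadratic (R : realType) (V : normedModType R) (F : V -> R)
    (x v : V) (a b : R) :
  (forall t, F (t *: v + x) = F x + t * a + t ^+ 2 * b) -> 'D_v F x = a.
Proof.
move=> FE; apply: cvg_lim => //=.
apply: (@cvg_trans _ ((fun t : R => a + t * b) @ 0^')).
  apply: near_eq_cvg; near=> t => /=.
  have t0 : t != 0 by near: t; exact: nbhs_dnbhs_neq.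
  by rewrite FE /GRing.scale /=; field.
suff ab : a + t * b @[t --> (0 : R)] --> a + 0 * b.
  by move: ab; rewrite mul0r addr0; exact: cvg_within_filter.
apply: cvgD; first exact: cvg_cst.
by apply: cvgM; [|exact: cvg_cst].
Unshelve. all: by end_near. Qed.

(** * Lie derivatives of negated and shifted functions *)

Section LieDerivatives.
Variables (R : realType) (n : nat) (f : 'cV[R]_n -> 'cV[R]_n).
Implicit Types h : 'cV[R]_n -> R.

Lemma grad_opp h x : grad (fun z => - h z) x = - grad h x.
Proof. by apply/rowP => j; rewrite !mxE derive_oppE. Qed.

(** The constant cancels inside the difference quotient, so both sides are the limit of the same
    function, convergent or not. *)
Lemma grad_addr h c x : grad (fun z => h z + c) x = grad h x.
Proof.
apply/rowP => j; rewrite !mxE /derive; set q := (X in X @ _).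
rewrite (_ : q = fun t => t^-1 *: ((h \o shift x) (t *: delta_mx j 0) - h x)) //.
by apply/funext => t; rewrite /q /= opprD addrACA subrr addr0.
Qed.

Lemma lie_iter_opp k h :
  lie_iter f k (fun z => - h z) = (fun z => - lie_iter f k h z).
Proof.
elim: k => [//|k IH]; rewrite /lie_iter !iterS -!/(lie_iter f k _) IH.
by apply/funext => x; rewrite /lie grad_opp mulNmx mxE.
Qed.

Lemma lie_iter_addr k h c :
  lie_iter f k (fun z => h z + c) =
  (fun z => lie_iter f k h z + (if k == 0%N then c else 0)).
Proof.
case: k => [//|k]; apply/funext => x; rewrite addr0.
(* Peeling off the innermost [lie] removes the constant at once. *)
rewrite /lie_iter !iterSr; congr (iter _ _ _ x).
by apply/funext => z; rewrite /lie grad_addr.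
Qed.

End LieDerivatives.

(** * Stationarity for a quadratic cost with affine constraints *)

Section QuadraticProgram.
Variables (R : realType) (m : nat) (I : finType).
Variables (G : 'M[R]_m) (c : I -> R) (d : I -> 'cV[R]_m) (k : 'cV[R]_m).
Hypothesis Gsym : G^T = G.

Lemma grad_lagrangian_qp_cost (lam : I -> R) (u : 'cV[R]_m) :
  grad (fun v => lagrangian (qp_cost G k) c d v lam) u =
  (G *m (u - k) - \sum_j lam j *: d j)^T.
Proof.
set z := u - k; set s := \sum_j _.
apply/rowP => j; rewrite mxE [RHS]mxE; set w := delta_mx j 0.
have D (A B : 'M[R]_1) : (A + B) 0 0 = A 0 0 + B 0 0 by rewrite mxE.
have Z a (A : 'M[R]_1) : (a *: A) 0 0 = a * A 0 0 by rewrite mxE.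
have T (A : 'M[R]_1) : A^T 0 0 = A 0 0 by rewrite mxE.
have pick (p : 'cV[R]_m) : (w^T *m p) 0 0 = p j 0.
  by rewrite /w trmx_delta -rowE mxE.
(* The constraints are affine, so the coefficient of [t ^+ 2] comes from the cost alone. *)
apply: (@derive_quadratic _ _ _ _ _ _ (2^-1 * (w^T *m G *m w) 0 0)) => t.
rewrite /lagrangian.
have -> : \sum_i lam i * constraint c d (t *: w + u) i =
    \sum_i lam i * constraint c d u i + t * s j 0.
  rewrite /s summxE mulr_sumr -big_split /=; apply: eq_bigr => i _.
  have -> : (lam i *: d i) j 0 = lam i * ((d i)^T *m w) 0 0.
    by rewrite mxE -pick -[X in _ * X]trace_mx11 -mxtrace_tr trmx_mul trmxK
      trace_mx11.
  rewrite /constraint mulmxDr -scalemxAr D Z.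
  by ring.
have -> : qp_cost G k (t *: w + u) = qp_cost G k u + t * (G *m z) j 0
    + t ^+ 2 * (2^-1 * (w^T *m G *m w) 0 0).
  rewrite /qp_cost -addrA -/z -(pick (G *m z)); clearbody z.
  rewrite [(t *: w + z)^T]linearD /= [(t *: w)^T]linearZ /= !(mulmxDl, mulmxDr).
  rewrite -!scalemxAl -!scalemxAr.
  (* By symmetry of [G] the two cross terms agree, and the factor [2^-1] leaves one copy of
     [G *m z]. *)
  have -> : z^T *m G *m w = (w^T *m (G *m z))^T.
    by rewrite !trmx_mul trmxK Gsym.
  rewrite -!mulmxA !(D, Z, T).
  by field.
by rewrite [in RHS]mxE [(- s) _ _]mxE; ring.
Qed.

(** Stationarity reads [G *m (u - k) = \sum_j lam j *: d j]; inverting [G] solves it for [u]. *)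
Lemma qp_stationary (lam : I -> R) (u : 'cV[R]_m) : G \in unitmx ->
  grad (fun v => lagrangian (qp_cost G k) c d v lam) u = 0 <->
  u = k + \sum_j lam j *: (invmx G *m d j).
Proof.
move=> Gu; rewrite grad_lagrangian_qp_cost.
have -> : \sum_j lam j *: (invmx G *m d j) = invmx G *m \sum_j lam j *: d j.
  by rewrite mulmx_sumr; apply: eq_bigr => j _; rewrite scalemxAr.
split=> [/(congr1 trmx)|->].
  by rewrite trmxK trmx0 => /subr0_eq <-; rewrite mulKmx // addrC subrK.
by rewrite addrAC subrr add0r mulKVmx // subrr trmx0.
Qed.

End QuadraticProgram.

(* With [wlo + wup > 0] the two multipliers of a pair of opposite bounds on the
   scalar [v = p - q] cannot both be positive. *)
Lemma box_multipliers (R : realType) (wlo wup p q : R) : 0 < wlo + wup ->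
  [/\ 0 <= wlo + (p - q), 0 <= wup - (p - q), 0 <= p, 0 <= q &
      p * (wlo + (p - q)) = 0 /\ q * (wup - (p - q)) = 0] <->
  p = Num.max 0 (- wlo) /\ q = Num.max 0 (- wup).
Proof.
move=> w0; split.
  move=> [lo up p0 q0 [/eqP + /eqP]]; rewrite !mulf_eq0.
  by move=> /orP[]/eqP ? /orP[]/eqP ?; split; case: ltP => ?; lra.
by move=> [-> ->]; case: (ltP 0 (- wlo)) => ?; case: (ltP 0 (- wup)) => ?;
  (exfalso; lra) || (split; [lra|lra|lra|lra|split; ring]).
Qed.

(** The difference of the maxima is the point closest to 0 in the interval from [- wlo] to [wup]:
    the lower end if that is positive, the upper end if that is negative, and 0 otherwise. *)
Lemma box_minimal (R : realType) (wlo wup v : R) : 0 < wlo + wup ->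
  0 <= wlo + v -> 0 <= wup - v ->
  (Num.max 0 (- wlo) - Num.max 0 (- wup)) ^+ 2 <= v ^+ 2.
Proof. by move=> w0 lo up; case: (ltP 0 (- wlo)) => ?; case: (ltP 0 (- wup)) => ?; nra. Qed.

(** * The barrier constraints in the decoupled coordinates *)

Section BarrierConstraints.
Variables (R : realType) (n m : nat).
Variables (f : 'cV[R]_n -> 'cV[R]_n) (g : 'cV[R]_n -> 'M[R]_(n, m)).
Variables (y : 'cV[R]_n -> 'cV[R]_m) (r : 'I_m -> nat).
Variables (alpha : 'I_m -> nat -> R) (ylo yup : 'I_m -> R).
Variables (kd : 'cV[R]_n -> 'cV[R]_m) (x : 'cV[R]_n) (i : 'I_m).
Hypothesis r_gt0 : (0 < r i)%N.

Local Notation B := (decoupling f g y r x).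

Lemma h_upE : h_up y yup i = (fun z => - component y i z + yup i).
Proof. by apply/funext => z; rewrite addrC. Qed.

(** The order-zero term is split off because it alone retains the bounds [ylo] and [yup]; for both
    barriers the remaining sum is, up to sign, the one in [drift]. *)
Lemma gain_H_vec h :
  ((gain_vec (r i) (alpha i))^T *m H_vec f (r i) h x) 0 0 =
  alpha i 1%N * h x + \sum_(1 <= j < r i) alpha i j.+1 * lie_iter f j h x.
Proof.
rewrite mxE; case: (r i) r_gt0 => [//|k] _.
rewrite big_ord_recl big_add1 big_mkord !mxE; congr (_ + _).
by apply: eq_bigr => j _; rewrite !mxE.
Qed.

Lemma qp_c_lo : qp_c f y r alpha ylo yup x (i, false) =
  drift f y r alpha i x + alpha i 1%N * (component y i x - ylo i).
Proof.
rewrite /qp_c /qp_barrier /= gain_H_vec /drift lie_iter_addr.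
rewrite eqn0Ngt r_gt0 /= addr0 -addrA; congr (_ + _); rewrite addrC.
congr (_ + _); apply: eq_big_nat => j /andP[j1 _].
by rewrite lie_iter_addr eqn0Ngt j1 addr0.
Qed.

Lemma qp_c_up : qp_c f y r alpha ylo yup x (i, true) =
  - drift f y r alpha i x - alpha i 1%N * (component y i x - yup i).
Proof.
rewrite /qp_c /qp_barrier /= gain_H_vec /drift h_upE lie_iter_addr lie_iter_opp.
rewrite eqn0Ngt r_gt0 /= addr0.
rewrite (eq_big_nat _ _ (F2 := fun j =>
    - (alpha i j.+1 * lie_iter f j (component y i) x))).
  by rewrite sumrN; ring.
move=> j /andP[j1 _].
by rewrite lie_iter_addr lie_iter_opp eqn0Ngt j1 addr0 mulrN.
Qed.

Lemma qp_d_lo : qp_d f g y r ylo yup x (i, false) = decoupling_vec f g y r i x.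
Proof.
by rewrite /qp_d /qp_barrier /decoupling_vec rowK lie_iter_addr /lie_in grad_addr.
Qed.

Lemma qp_d_up :
  qp_d f g y r ylo yup x (i, true) = - decoupling_vec f g y r i x.
Proof.
rewrite /qp_d /qp_barrier /decoupling_vec rowK /= h_upE lie_iter_addr.
by rewrite lie_iter_opp /lie_in grad_addr grad_opp mulNmx linearN.
Qed.

Lemma decoupling_vec_mul (u : 'cV[R]_m) :
  ((decoupling_vec f g y r i x)^T *m u) 0 0 = (B *m u) i 0.
Proof. by rewrite trmxK -row_mul mxE. Qed.

(** Splitting [u] as [kd x + (u - kd x)] absorbs [B *m kd x] into [omega_lo], so only the [i]-th
    decoupled coordinate of [u] remains. *)
Lemma constraint_lo u :
  constraint (qp_c f y r alpha ylo yup x) (qp_d f g y r ylo yup x) u (i, false) =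
  omega_lo f g y r alpha ylo kd i x + (B *m (u - kd x)) i 0.
Proof.
rewrite /constraint qp_c_lo qp_d_lo /omega_lo !decoupling_vec_mul.
by rewrite mulmxBr !mxE; ring.
Qed.

Lemma constraint_up u :
  constraint (qp_c f y r alpha ylo yup x) (qp_d f g y r ylo yup x) u (i, true) =
  omega_up f g y r alpha yup kd i x - (B *m (u - kd x)) i 0.
Proof.
have N (A : 'M[R]_1) : (- A) 0 0 = - A 0 0 by rewrite mxE.
rewrite /constraint qp_c_up qp_d_up /omega_up linearN mulNmx N.
by rewrite !decoupling_vec_mul mulmxBr !mxE; ring.
Qed.

Lemma omega_add_gt0 : 0 < alpha i 1%N -> ylo i < yup i ->
  0 < omega_lo f g y r alpha ylo kd i x + omega_up f g y r alpha yup kd i x.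
Proof.
move=> a0 lu; rewrite /omega_lo /omega_up.
by have := mulr_gt0 a0 (_ : 0 < yup i - ylo i); rewrite subr_gt0 => /(_ lu); lra.
Qed.

End BarrierConstraints.

Lemma qp_cost_gram (R : realType) (m : nat) (B : 'M[R]_m) (k u : 'cV[R]_m) :
  qp_cost (B^T *m B) k u = 2^-1 * \sum_i (B *m (u - k)) i 0 ^+ 2.
Proof.
rewrite /qp_cost mulmxA -mulmxA -trmx_mul mxE; congr (_ * _).
by apply: eq_bigr => i _; rewrite mxE expr2.
Qed.

(** With [e_i] the basis vector, [b_i = B^T e_i = (B^T B) B^-1 e_i], hence [G^-1 b_i = B^-1 e_i]. *)
Lemma mul_gram_inv_row (R : realType) (m : nat) (B : 'M[R]_m) (i : 'I_m) :
  B \in unitmx -> B *m (invmx (B^T *m B) *m (row i B)^T) = delta_mx i 0.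
Proof.
move=> Bu; have -> : (row i B)^T = B^T *m B *m (invmx B *m delta_mx i 0).
  by rewrite -mulmxA mulKVmx // rowE trmx_mul trmx_delta.
by rewrite mulKmx ?mulKVmx // unitmx_mul unitmx_tr Bu.
Qed.

Theorem theorem3 (R : realType) (n m : nat)
    (f : 'cV[R]_n -> 'cV[R]_n) (g : 'cV[R]_n -> 'M[R]_(n, m))
    (y : 'cV[R]_n -> 'cV[R]_m) (r : 'I_m -> nat)
    (alpha nu : 'I_m -> nat -> R) (ylo yup : 'I_m -> R)
    (E : set 'cV[R]_n) (kd : 'cV[R]_n -> 'cV[R]_m)
    (k : nat) (hk : forall i, (r i <= k)%N)
    (hf : Ck k f) (hg : Ck k g) (hy : Ck k y)
    (hgains : forall i, stable_gains (r i) (alpha i) (nu i))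
    (hE : open E) (hSE : safe_set f y r nu ylo yup `<=` E)
    (hr : vector_relative_degree_on f g y r E)
    (halpha : forall i, 0 < alpha i 1%N)
    (hbounds : forall i, ylo i < yup i) :
  forall x, E x ->
  forall (u : 'cV[R]_m) (lam : 'I_m * bool -> R),
  primal_dual_solution
    (qp_cost (qp_weight f g y r x) (kd x))
    (qp_c f y r alpha ylo yup x)
    (qp_d f g y r ylo yup x)
    u lam
  <->
  [/\ u = kd x + \sum_(i < m)
            (lam (i, false) - lam (i, true))
              *: (invmx (qp_weight f g y r x) *m decoupling_vec f g y r i x),
      forall i, lam (i, false) =
        Num.max 0 (- omega_lo f g y r alpha ylo kd i x) &
      forall i, lam (i, true) =
        Num.max 0 (- omega_up f g y r alpha yup kd i x)].
Proof.
move=> x Ex u lam; have [r0 /(_ x Ex)[_ Bu]] := hr.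
set B := decoupling f g y r x in Bu.
set wlo := fun i => omega_lo f g y r alpha ylo kd i x.
set wup := fun i => omega_up f g y r alpha yup kd i x.
set c := qp_c _ _ _ _ _ _ _; set d := qp_d _ _ _ _ _ _ _.
have clo w i : constraint c d w (i, false) = wlo i + (B *m (w - kd x)) i 0.
  exact: constraint_lo.
have cup w i : constraint c d w (i, true) = wup i - (B *m (w - kd x)) i 0.
  exact: constraint_up.
have w0 i : 0 < wlo i + wup i by exact: omega_add_gt0.
have Gsym : (qp_weight f g y r x)^T = qp_weight f g y r x.
  by rewrite trmx_mul trmxK.
have Gu : qp_weight f g y r x \in unitmx by rewrite unitmx_mul unitmx_tr Bu.
have stat := qp_stationary c d (kd x) Gsym lam u Gu.
have pairE : \sum_j lam j *: (invmx (qp_weight f g y r x) *m d j) =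
    \sum_(i < m) (lam (i, false) - lam (i, true))
      *: (invmx (qp_weight f g y r x) *m decoupling_vec f g y r i x).
  (* Grouping the two constraints of each output, whose vectors [d] are opposite, produces the
     difference of multipliers. *)
  transitivity (\sum_(i < m) \sum_(b : bool)
      lam (i, b) *: (invmx (qp_weight f g y r x) *m d (i, b))).
    by rewrite pair_bigA; apply: eq_bigr => -[].
  apply: eq_bigr => i _; rewrite big_bool /= /d qp_d_lo qp_d_up.
  by rewrite mulmxN scalerN scalerBl addrC.
rewrite pairE in stat.
have vE : u = kd x + \sum_(i < m) (lam (i, false) - lam (i, true))
      *: (invmx (qp_weight f g y r x) *m decoupling_vec f g y r i x) ->
    forall i, (B *m (u - kd x)) i 0 = lam (i, false) - lam (i, true).
  move=> -> i; rewrite addrAC subrr add0r mulmx_sumr summxE (bigD1 i) //=.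
  rewrite big1 => [|j ji]; rewrite -scalemxAr mul_gram_inv_row // !mxE eqxx.
    by rewrite eqxx mulr1 addr0.
  by rewrite eq_sym (negbTE ji) mulr0.
split.
  move=> [_ [/stat uE feas lam0 compl]].
  (* Stationarity gives [v_i = p - q], so the other KKT conditions for output [i] become the scalar
     system of [box_multipliers]. *)
  have mult i : lam (i, false) = Num.max 0 (- wlo i) /\
                lam (i, true) = Num.max 0 (- wup i).
    apply/(box_multipliers _ _ (w0 i)); rewrite -vE // -clo -cup.
    by split; rewrite ?feas ?lam0 ?compl.
  by split=> // i; case: (mult i).
move=> [uE lo up].
(* Conversely, the formulas for the multipliers return feasibility, signs and complementary
   slackness. *)
have box i := (box_multipliers (lam (i, false)) (lam (i, true)) (w0 i)).2
  (conj (lo i) (up i)).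
have feas : feasible c d u.
  by move=> [i []]; rewrite ?clo ?cup vE //; case: (box i).
split; last first.
  split=> //; first exact/stat.
    by move=> [i []]; case: (box i).
  by move=> [i []]; rewrite ?clo ?cup vE //; case: (box i) => _ _ _ _ [].
(* Both costs are half sums of squares of decoupled coordinates, and the bounds constrain each
   coordinate separately, so the comparison with [w] is made coordinate by coordinate. *)
split=> // w wfeas; rewrite !qp_cost_gram ler_pM2l ?invr_gt0 ?ltr0n //.
apply: ler_sum => i _; rewrite vE // lo up; apply: (box_minimal (w0 i)).
  by rewrite -clo.
by rewrite -cup.
Qed.
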